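(* Let $N$ be an abelian normal subgroup of a finite group $G$. Then an automorphism $\theta$ of $N$ extends to an automorphism of $G$ centralizing $G/N$ if and only if, for each prime number $p$ dividing $|G/N|$, there is some Sylow $p$-subgroup $P/N$ of $G/N$ such that $\theta$ extends to an automorphism of $P$ centralizing $P/N$.
   Context: For a subgroup $P$ with $N\le P\le G$, ''$\theta$ extends to an automorphism of $P$ centralizing $P/N$'' means that there is an automorphism $\gamma$ of $P$ with $\gamma|_N=\theta$ and $\gamma(g)N=gN$ for all $g\in P$. The case $P=G$ gives the meaning of ''$\theta$ extends to an automorphism of $G$ centralizing $G/N$''. *)

(* Defs.v *)
From mathcomp Require Import all_boot all_fingroup all_solvable.

Set Implicit Arguments.
Unset Strict Implicit.
Unset Printing Implicit Defensive.

Local Open Scope group_scope.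

(* Intended for [N \subset P], [N <| P] and [theta \in Aut N].  Elements of [Aut A] are
   permutations of the whole of [gT] that fix every point outside [A], so [gamma]
   and [theta] are only compared on [N]. *)
Definition extends_centralizing_quotient (gT : finGroupType) (N P : {group gT})
    (theta : {perm gT}) : Prop :=
  exists gamma : {perm gT},
    [/\ gamma \in Aut P,
        {in N, gamma =1 theta}
      & {in P, forall g, gamma g *: N = g *: N}].

(* Main.v *)
Require Import Defs.
From mathcomp Require Import all_boot all_fingroup all_solvable.
From mathcomp Require Import ssralg.

Import GRing.Theory FiniteModule.

Local Open Scope group_scope.

(* Writing gamma g = g * d g, an extension of theta to P centralizing P / N is
   the same as a crossed homomorphism d : P -> N extending n |-> n^-1 * theta n.
   The integers k such that k times the latter map extends to a crossed
   homomorphism on G are closed under gcd.  They contain #|G : N| and, by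
   corestriction from the given subgroups P, integers #|G : P| prime to each
   prime divisor of #|G : N|; hence they contain 1.  Corestriction needs the map
   on N to be G-equivariant; this holds because the subgroup of G commuting with
   it contains all the P, so that its index in G is 1. *)

Section CrossedHom.

Set Implicit Arguments.
Unset Strict Implicit.
Unset Printing Implicit Defensive.

Variables (gT : finGroupType) (N : {group gT}) (abelN : abelian N).
Implicit Types (G P : {group gT}) (d : gT -> fmod_of abelN).

Definition crossed_hom (A : {set gT}) d :=
  {in A &, forall x y, d (x * y) = (d x ^@ y + d y)%R}.

Lemma fmod_act_trivial (u : fmod_of abelN) x : x \in N -> (u ^@ x)%R = u.
Proof.
move=> Nx; apply: val_inj; rewrite /= fmvalJ ?(subsetP (normG N)) //.
by rewrite conjgE ((centsP abelN) _ (fmodP u) _ Nx) mulKg.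
Qed.

(** Expand [d] on both sides of [x * n ^ x = n * x]; since [n ^ x] lies in [N], it acts trivially on
    [d x]. *)
Lemma crossed_homJ P d : N <| P -> crossed_hom P d ->
  {in N & P, forall n x, d (n ^ x) = (d n ^@ x)%R}.
Proof.
case/andP=> sNP nNP dP n x Nn Px; have Pn := subsetP sNP n Nn.
have Nnx: n ^ x \in N by rewrite memJ_norm ?(subsetP nNP).
apply: (addrI (d x)); rewrite -{1}(fmod_act_trivial (d x) Nnx) -dP //.
  by rewrite -conjgC dP // addrC.
exact: subsetP sNP _ Nnx.
Qed.

(** Corestriction, written with coset representatives. On [N], equivariance makes each coset of [P]
    contribute one copy of [d n]. *)
Lemma crossed_hom_transfer G P d :
    N <| G -> N \subset P -> P \subset G -> crossed_hom P d ->
    {in N & G, forall n x, d (n ^ x) = (d n ^@ x)%R} ->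
  exists2 D : gT -> fmod_of abelN, crossed_hom G D
    & {in N, forall n, D n = (d n *+ #|G : P|)%R}.
Proof.
move=> nsNG sNP sPG dP dJ; have nNG := subsetP (normal_norm nsNG).
pose r (X : {set gT}) := repr X.
(* The factor in [P] with [r X * g = t X g * r (X :* g)]. *)
pose t X g := r X * g * (r (X :* g))^-1.
pose D g := (\sum_(X in rcosets P G) d (t X g) ^@ r (X :* g)%g)%R.
have rG X : X \in rcosets P G -> r X \in G /\ X = P :* r X.
  case/rcosetsP=> x Gx ->; rewrite /r; case: repr_rcosetP => y Py.
  split; first exact: groupM (subsetP sPG y Py) Gx.
  by rewrite rcosetM (rcoset_id Py).
have rM X g : g \in G -> X \in rcosets P G -> X :* g \in rcosets P G.
  move=> Gg /rG[GrX ->]; rewrite -rcosetM -rcosetE imset_f //.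
  exact: groupM.
have rP X g : g \in G -> X \in rcosets P G -> t X g \in P.
  move=> Gg PX; have [_ eX] := rG _ PX.
  rewrite -mem_rcoset; have [_ <-] := rG _ (rM _ _ Gg PX).
  by rewrite {2}eX mem_rcoset -mulgA mulgV mulg1 mem_rcoset mulgV.
exists D => [g h Gg Gh | n Nn].
  (* Right translation by [g] permutes the cosets, so the sum for [h] may run over [X :* g]. *)
  have ->: D h = (\sum_(X in rcosets P G)
      d (t (X :* g)%g h) ^@ r (X :* g :* h)%g)%R.
    rewrite /D (reindex_acts 'Rs _ Gg) ?actsRs_rcosets //.
    by apply: eq_bigr => X _ /=; rewrite rcosetE.
  rewrite /D actr_sum -big_split; apply: eq_bigr => X PX /=.
  have PXg := rM _ _ Gg PX; have PXgh := rM _ _ Gh PXg.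
  have [GrXg _] := rG _ PXg; have [GrXgh _] := rG _ PXgh.
  have Ptg := rP _ _ Gg PX; have Pth := rP _ _ Gh PXg.
  have ->: t X (g * h) = t X g * t (X :* g) h.
    by rewrite /t rcosetM !mulgA mulgKV.
  (* As [t (X :* g) h * r (X :* g :* h) = r (X :* g) * h], the first summand is the term of [D g]
     acted on by [h]. *)
  rewrite rcosetM dP // actAr -!actrM ?nNG ?(subsetP sPG _ Pth) //.
  by rewrite /t mulgKV.
rewrite -sumr_const; apply: eq_bigr => X PX; have [GrX eX] := rG _ PX.
have Gn := subsetP (normal_sub nsNG) n Nn.
(* [N] is normal in [G] and lies in [P], so [n] fixes every right coset of [P]. *)
have eXn: X :* n = X.
  rewrite {1}eX -rcosetM conjgCV rcosetM rcoset_id -?eX //.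
  by rewrite (subsetP sNP) // memJ_norm // groupV nNG.
have ->: t X n = n ^ (r X)^-1 by rewrite /t eXn conjgE invgK mulgA.
by rewrite eXn dJ ?groupV // -{2}(invgK (r X)) actrK.
Qed.

(** Bezout with natural coefficients, [km * m = kn * n + gcdn m n], applied to the pointwise
    combination of [d1] and [d2]. *)
Lemma crossed_hom_gcd G d d1 d2 m n : (0 < m)%N ->
    crossed_hom G d1 -> {in N, forall x, d1 x = (d x *+ m)%R} ->
    crossed_hom G d2 -> {in N, forall x, d2 x = (d x *+ n)%R} ->
  exists2 D : gT -> fmod_of abelN, crossed_hom G D
    & {in N, forall x, D x = (d x *+ gcdn m n)%R}.
Proof.
move=> m_gt0 d1G d1N d2G d2N; case: (egcdnP n m_gt0) => km kn kmE _.
exists (fun x => (d1 x *+ km - d2 x *+ kn)%R) => [x y Gx Gy | x Nx] /=.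
  rewrite d1G // d2G // actAr actNr !actZr !mulrnDl opprD.
  by rewrite !addrA; congr (_ + _)%R; rewrite addrAC.
rewrite d1N // d2N // -!mulrnA [(m * km)%N]mulnC [(n * kn)%N]mulnC kmE.
by rewrite mulrnDr addrC addKr.
Qed.

Lemma crossed_hom_extend G d : N <| G -> crossed_hom N d ->
    (forall p, prime p -> p %| #|G / N| ->
       exists P : {group gT}, [/\ N \subset P, P \subset G,
         p.-Sylow(G / N) (P / N)
       & exists2 d' : gT -> fmod_of abelN, crossed_hom P d' & {in N, d' =1 d}]) ->
  exists2 D : gT -> fmod_of abelN, crossed_hom G D & {in N, D =1 d}.
Proof.
move=> nsNG dN sylE; have [sNG nNG] := andP nsNG.
have indexP (P : {group gT}) p : N \subset P -> P \subset G ->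
    p.-Sylow(G / N) (P / N) -> prime p -> ~~ (p %| #|G : P|).
  move=> sNP sPG /and3P[_ _]; rewrite index_quotient_eq ?subIset ?sNP ?orbT //.
  by move=> p'i p_pr; rewrite -p'natE.
pose C := [set x in G | [forall n in N, d (n ^ x) == (d n ^@ x)%R]].
have gC: group_set C.
  apply/group_setP; split=> [|x y].
    by rewrite inE group1; apply/forall_inP=> n _; rewrite conjg1 actr1.
  rewrite !inE => /andP[Gx /forall_inP Cx] /andP[Gy /forall_inP Cy].
  rewrite groupM //=; apply/forall_inP=> n Nn.
  rewrite conjgM actrM ?(subsetP nNG) // -(eqP (Cx n Nn)) Cy //.
  by rewrite memJ_norm ?(subsetP nNG).
have sCG: Group gC \subset G by apply/subsetP=> x; rewrite inE => /andP[].
have sCP (P : {group gT}) d' : N \subset P -> P \subset G -> crossed_hom P d' ->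
    {in N, d' =1 d} -> P \subset Group gC.
  move=> sNP sPG dP dE; apply/subsetP=> x Px.
  rewrite inE (subsetP sPG) //; apply/forall_inP=> n Nn.
  rewrite -!dE ?memJ_norm ?(subsetP nNG) ?(subsetP sPG) //.
  by rewrite (crossed_homJ (normalS sNP sPG nsNG)).
have dJ: {in N & G, forall n x, d (n ^ x) = (d n ^@ x)%R}.
  have iGN: #|G / N| = #|G : N| by rewrite card_quotient.
  have sNC: N \subset Group gC by apply: sCP dN _.
  suffices i1: #|G : Group gC| = 1%N.
    have sGC: G \subset Group gC by rewrite -indexg_eq1 i1.
    move=> n x Nn Gx; have := subsetP sGC x Gx.
    by rewrite inE => /andP[_ /forall_inP/(_ n Nn)/eqP].
  (* A prime dividing [#|G : C|] divides [#|G / N|], because [C] contains [N]. The [P] given for it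
     lies in [C], so the prime would divide [#|G : P|]. *)
  apply/eqP; case: eqP => // /eqP i_neq1.
  have p_pr: prime (pdiv #|G : Group gC|).
    by rewrite pdiv_prime // ltn_neqAle eq_sym i_neq1 indexg_gt0.
  have p_dv := pdiv_dvd #|G : Group gC|.
  have [|P [sNP sPG sylP [d' dP dE]]] := sylE _ p_pr.
    by rewrite iGN -(Lagrange_index sCG sNC) dvdn_mulr.
  case/negP: (indexP _ _ sNP sPG sylP p_pr).
  by rewrite -(Lagrange_index sCG (sCP _ _ sNP sPG dP dE)) dvdn_mulr.
have transferE (P : {group gT}) d' : N \subset P -> P \subset G ->
    crossed_hom P d' -> {in N, d' =1 d} ->
    exists2 D : gT -> fmod_of abelN, crossed_hom G D
      & {in N, forall n, D n = (d n *+ #|G : P|)%R}.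
  move=> sNP sPG dP dE; have [|D DG DN] := crossed_hom_transfer nsNG sNP sPG dP.
    by move=> n x Nn Gx; rewrite !dE ?memJ_norm ?(subsetP nNG) ?dJ.
  by exists D => // n Nn; rewrite DN ?dE.
have [D0 D0G D0N] := transferE _ _ (subxx N) sNG dN (fun x _ => erefl).
(* Naming the multiplier [k] lets the induction vary it alone, remembering only that it divides
   [#|G : N|]. *)
have [k kE] : {k | k = #|G : N|} by exists #|G : N|.
have k_dv : k %| #|G : N| by rewrite kE.
rewrite -kE in D0N; elim/ltn_ind: k D0 D0G D0N k_dv {kE} => k IHk D0 D0G D0N k_dv.
have k_gt0: (0 < k)%N by apply: dvdn_gt0 k_dv; apply: indexg_gt0.
have [k1 | k_neq1] := eqVneq k 1%N.
  by exists D0 => // n Nn; rewrite D0N // k1 mulr1n.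
have p_pr: prime (pdiv k) by rewrite pdiv_prime // ltn_neqAle eq_sym k_neq1.
have [|P [sNP sPG sylP [d' dP dE]]] := sylE _ p_pr.
  by rewrite card_quotient // (dvdn_trans (pdiv_dvd k)).
have [D1 D1G D1N] := transferE _ _ sNP sPG dP dE.
have [D DG DN] := crossed_hom_gcd k_gt0 D0G D0N D1G D1N.
apply: IHk DG DN (dvdn_trans (dvdn_gcdl _ _) k_dv).
(* The gcd is smaller than [k]: otherwise [pdiv k] would divide [#|G : P|]. *)
rewrite ltn_neqAle dvdn_leq ?dvdn_gcdl // andbT.
apply: contra (indexP _ _ sNP sPG sylP p_pr) => /eqP/gcdn_idPl.
exact: dvdn_trans (pdiv_dvd k).
Qed.

(** Meaningful only where [x^-1 * theta x] lies in [N], that is, where [theta x] stays in the coset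
    [x *: N]. *)
Definition displacement (theta : {perm gT}) x := fmod abelN (x^-1 * theta x).

Lemma extends_crossed_hom P (theta : {perm gT}) : N <| P -> theta \in Aut N ->
  extends_centralizing_quotient N P theta <->
  exists2 d : gT -> fmod_of abelN, crossed_hom P d
    & {in N, d =1 displacement theta}.
Proof.
move=> nsNP AutN; have [sNP nNP] := andP nsNP; split.
  case=> gamma [AutP gN gQ]; exists (displacement gamma) => [x y Px Py | x Nx].
    have N_ z : z \in P -> z^-1 * gamma z \in N.
      by move=> Pz; rewrite -mem_lcoset -gQ // lcoset_refl.
    have Ny := subsetP nNP y Py.
    rewrite /displacement -fmodJ // -fmodM ?memJ_norm ?N_ //.
    rewrite (morphicP (Aut_morphic AutP)) // conjgE; congr (fmod _ _).
    by rewrite !invMg !mulgA mulgK.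
  by rewrite /displacement gN.
case=> d dP dE; pose f x := x * fmval (d x).
have fM: {in P &, {morph f : x y / x * y}}.
  move=> x y Px Py; rewrite /f dP // fmvalA fmvalJ ?(subsetP nNP) // conjgE.
  by rewrite !mulgA mulgK.
have fN: {in N, f =1 theta}.
  move=> x Nx; rewrite /f dE // /displacement fmodK ?mulKVg //.
  by rewrite groupM ?groupV ?Aut_closed.
(* If [f x = 1], then [x^-1] is a value of [d], so [x] lies in [N], where [f] is the injective
   [theta]. *)
have inj_f: 'injm (Morphism fM).
  apply/subsetP=> x /[!inE] /andP[Px /eqP /= fx1].
  have Nx: x \in N.
    by rewrite -groupV -[x^-1]mulg1 -fx1 /f mulKg fmodP.
  apply/eqP/(@perm_inj _ theta); rewrite -fN // fx1.
  exact/esym/(morph1 (autm_morphism AutN)).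
(* [f] maps [P] into itself, and injectivity gives equality by cardinality. *)
have im_f: Morphism fM @* P = P.
  apply/eqP; rewrite eqEcard card_injm // leqnn andbT.
  apply/subsetP=> _ /morphimP[x _ Px ->] /=.
  by rewrite /f groupM // (subsetP sNP) ?fmodP.
exists (aut inj_f im_f); split=> [|x Nx|x Px].
- exact: Aut_aut.
- by rewrite autE ?(subsetP sNP) //= fN.
by rewrite autE //= /f lcosetM lcoset_id ?fmodP.
Qed.

(** Case [P = N] of the correspondence: [theta] extends itself, and it centralizes the trivial
    quotient [N / N]. *)
Lemma displacement_crossed_hom (theta : {perm gT}) :
  theta \in Aut N -> crossed_hom N (displacement theta).
Proof.
move=> AutN; have [|d dN dE] := (extends_crossed_hom (normal_refl N) AutN).1.
  by exists theta; split=> // x Nx; rewrite !lcoset_id ?Aut_closed.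
by move=> x y Nx Ny; rewrite -!dE ?groupM // dN.
Qed.

End CrossedHom.

Theorem theorem7 (gT : finGroupType) (G N : {group gT}) (theta : {perm gT})
    (nsNG : N <| G) (abelN : abelian N) (AutNtheta : theta \in Aut N) :
  extends_centralizing_quotient N G theta <->
  (forall p : nat, prime p -> p %| #|G / N| ->
     exists P : {group gT},
       [/\ N \subset P, P \subset G, p.-Sylow(G / N) (P / N)
         & extends_centralizing_quotient N P theta]).
Proof.
have extE (P : {group gT}) : N \subset P -> P \subset G -> _ :=
  fun sNP sPG => extends_crossed_hom abelN (normalS sNP sPG nsNG) AutNtheta.
have sNG := normal_sub nsNG; split=> [|sylE].
  case/(extE G sNG (subxx G)) => d dG dE p p_pr _.
  have [Q sylQ] := Sylow_exists p (G / N).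
  have [P defQ sNP sPG] := inv_quotientS nsNG (pHall_sub sylQ).
  exists P; split=> //; first by rewrite -defQ.
  (* A crossed homomorphism simply restricts to [P], so stability of [P] under the automorphism of
     [G] needs no separate check. *)
  by apply/(extE P sNP sPG); exists d => //; apply: sub_in2 dG; apply/subsetP.
apply/(extE G sNG (subxx G))/crossed_hom_extend => //.
  exact: displacement_crossed_hom.
move=> p p_pr p_dv; have [P [sNP sPG sylP extP]] := sylE p p_pr p_dv.
by exists P; split=> //; apply/(extE P sNP sPG).
Qed.
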